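(* $\mathrm{NICF}_4 + \mathrm{NICF}_4 \neq \mathbb{R}$, i.e., there is a real number $z$ that cannot be written as $z = x + y$ with $x, y \in \mathrm{NICF}_4$.
   Context: The nearest integer continued fraction (NICF) expansion $[a_0; a_1, a_2, \ldots]$ of a real number $x$ is obtained by setting $x_0 = x$ and iterating $a_i = \lfloor x_i \rceil$ (nearest integer) and $x_{i+1} = 1/(x_i - a_i)$ as long as $x_i \ne a_i$. For $r \ge 2$, $\mathrm{NICF}_r$ denotes the set of real numbers $x$ whose NICF expansion $[a_0;a_1,a_2,\ldots]$ satisfies $|a_i| \le r$ for all $i \ge 1$. *)

(* Defs.v *)
From Stdlib Require Import Reals ZArith.
Open Scope R_scope.

(* Ties are rounded up, so that x - nearest_int x lies in [-1/2, 1/2);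
   Stdlib's Int_part is the floor function on all of R. *)
Definition nearest_int (x : R) : Z := Int_part (x + 1 / 2).

(* The complete quotient x_i; None once the expansion has terminated. *)
Fixpoint nicf_quotient (x : R) (i : nat) : option R :=
  match i with
  | O => Some x
  | S j =>
      match nicf_quotient x j with
      | None => None
      | Some xj =>
          if Req_dec_T xj (IZR (nearest_int xj)) then None
          else Some (/ (xj - IZR (nearest_int xj)))
      end
  end.

Definition nicf_digit (x : R) (i : nat) : option Z :=
  option_map nearest_int (nicf_quotient x i).

(* The digit a_0 is unrestricted, and rationals (finite expansions) are allowed. *)
Definition NICF (r : Z) (x : R) : Prop :=
  forall (i : nat) (a : Z),
    (1 <= i)%nat -> nicf_digit x i = Some a -> (Z.abs a <= r)%Z.

(* Main.v *)
Require Import Defs.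
From Stdlib Require Import Reals ZArith.
From Stdlib Require Import List Bool Lra Lia.
Import ListNotations.
Open Scope R_scope.

(** Let F be the set of remainders x - a_0 with x in NICF_4. A nonzero element
    of F has the form 1/(a + u) with u in F and 2 <= |a| <= 4, where u >= 0 if
    a = 2 and u <= 0 if a = -2. If x + y = 59/94 with x, y in NICF_4, then the
    remainders u, v of x and y satisfy 94 u + 94 v = 59 or 94 u + 94 v = -35.
    Substituting u = 1/(a + u') in a relation A u v + B u + C v + D = 0 and
    clearing the denominator gives a relation of the same shape with integer
    coefficients. A bilinear form whose values at the corners of a box have the
    same strict sign does not vanish on the box; expanding u and v alternately,
    at most ten times in all, this excludes every branch. *)

Definition remainder (r : Z) (s : R) : Prop :=
  exists x, NICF r x /\ s = x - IZR (nearest_int x).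

Lemma nearest_int_bounds (x : R) :
  -1 / 2 <= x - IZR (nearest_int x) < 1 / 2.
Proof.
  unfold nearest_int.
  destruct (base_Int_part (x + 1 / 2)); lra.
Qed.

Lemma remainder_bounds (r : Z) (s : R) : remainder r s -> -1 / 2 <= s < 1 / 2.
Proof. intros [x [_ ->]]; apply nearest_int_bounds. Qed.

Lemma nicf_quotient_shift (x : R) (i : nat) :
  x <> IZR (nearest_int x) ->
  nicf_quotient (/ (x - IZR (nearest_int x))) i = nicf_quotient x (S i).
Proof.
  intros Hx; induction i as [|i IH].
  - simpl; destruct (Req_dec_T x (IZR (nearest_int x))); [contradiction|reflexivity].
  - change (nicf_quotient x (S (S i))) with
      (match nicf_quotient x (S i) with
       | None => None
       | Some xj => if Req_dec_T xj (IZR (nearest_int xj)) then None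
                    else Some (/ (xj - IZR (nearest_int xj)))
       end).
    rewrite <- IH; reflexivity.
Qed.

(** As [s] lies in [-1/2, 1/2), its inverse is above 2 or at most -2. Rounding therefore gives a
    digit of absolute value at least 2, and the digits 2 and -2 can only come from rounding toward
    zero, which fixes the sign of [u]. *)
Lemma remainder_step (r : Z) (s : R) :
  remainder r s -> s <> 0 ->
  exists (a : Z) (u : R),
    remainder r u /\ s * (IZR a + u) = 1 /\
    (0 < s /\ (2 <= a <= r)%Z \/ s < 0 /\ (- r <= a <= -2)%Z) /\
    (a = 2%Z -> 0 <= u) /\ (a = (-2)%Z -> u <= 0).
Proof.
  intros [x [Hx Es]] Hs.
  assert (Hne : x <> IZR (nearest_int x)) by lra.
  pose proof (nearest_int_bounds x) as Hb; rewrite <- Es in Hb.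
  pose proof (fun i => nicf_quotient_shift x i Hne) as Hq; rewrite <- Es in Hq.
  set (y := / s) in *.
  assert (Hsy : s * y = 1) by (apply Rinv_r; exact Hs).
  pose proof (nearest_int_bounds y) as Hy.
  exists (nearest_int y), (y - IZR (nearest_int y)).
  assert (Ha : (Z.abs (nearest_int y) <= r)%Z).
  { apply (Hx 1%nat); [lia|].
    unfold nicf_digit; rewrite <- Hq; reflexivity. }
  split; [|split; [|split; [|split]]].
  - exists y; split; [|reflexivity].
    (* The expansion of [y] is that of [x] with its first term dropped. *)
    intros i a Hi Hd; apply (Hx (S i)); [lia|].
    unfold nicf_digit in *; rewrite <- Hq; exact Hd.
  - rewrite <- Hsy; ring.
  - destruct (Rlt_or_le 0 s) as [Hpos|Hneg].
    + left; split; [exact Hpos|].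
      assert (2 < y) by nra.
      assert (1 < nearest_int y)%Z by (apply lt_IZR; lra).
      lia.
    + right; split; [lra|].
      assert (y <= -2) by nra.
      assert (nearest_int y < -1)%Z by (apply lt_IZR; lra).
      lia.
  - intros E; rewrite E in *.
    destruct (Rlt_or_le 0 s); [assert (2 < y) by nra|assert (y <= -2) by nra]; lra.
  - intros E; rewrite E in *.
    destruct (Rlt_or_le 0 s); [assert (2 < y) by nra|assert (y <= -2) by nra]; lra.
Qed.

(** [Zero] stands for a remainder known to vanish, that is, a terminated expansion. It admits no
    digit, so its turn in the search merely exchanges the unknowns. *)
Inductive sign := Any | Nonneg | Nonpos | Zero.

(* Bounds are in units of 1/2. *)
Definition lo (c : sign) : Z :=
  match c with Any | Nonpos => -1 | Nonneg | Zero => 0 end.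

Definition hi (c : sign) : Z :=
  match c with Any | Nonneg => 1 | Nonpos | Zero => 0 end.

Definition digits (c : sign) : list Z :=
  match c with
  | Any => [2; 3; 4; -2; -3; -4]
  | Nonneg => [2; 3; 4]
  | Nonpos => [-2; -3; -4]
  | Zero => []
  end%Z.

Definition sign_after (a : Z) : sign :=
  if (a =? 2)%Z then Nonneg else if (a =? -2)%Z then Nonpos else Any.

Definition in_box (c : sign) (u : R) : Prop :=
  IZR (lo c) <= 2 * u <= IZR (hi c).

Lemma remainder_digits (c : sign) (s : R) :
  remainder 4 s -> in_box c s -> s <> 0 ->
  exists (a : Z) (u : R),
    In a (digits c) /\ remainder 4 u /\ in_box (sign_after a) u /\
    s * (IZR a + u) = 1.
Proof.
  intros Hr Hc Hs.
  destruct (remainder_step 4 s Hr Hs) as (a & u & Hu & E & Ha & H2 & Hm2).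
  exists a, u; repeat split; trivial.
  - assert (Hd : 0 < s /\ (a = 2 \/ a = 3 \/ a = 4)%Z \/
                 s < 0 /\ (a = -2 \/ a = -3 \/ a = -4)%Z)
      by (destruct Ha as [[? ?]|[? ?]]; [left|right]; (split; [assumption|lia])).
    unfold in_box in Hc.
    destruct c; simpl in *; try (exfalso; lra);
      destruct Hd as [[? Hd]|[? Hd]]; try (exfalso; lra);
      repeat destruct Hd as [Hd|Hd]; subst; tauto.
  - apply remainder_bounds in Hu; unfold sign_after.
    destruct (Z.eqb_spec a 2) as [->|_]; [simpl; specialize (H2 eq_refl); lra|].
    destruct (Z.eqb_spec a (-2)) as [->|_]; simpl; lra.
  - apply remainder_bounds in Hu; unfold sign_after.
    destruct (Z.eqb_spec a 2) as [->|_]; [simpl; lra|].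
    destruct (Z.eqb_spec a (-2)) as [->|_]; simpl; [specialize (Hm2 eq_refl)|]; lra.
Qed.

(** Four times the form at (i/2, j/2), which keeps the test in integers. *)
Definition corner (A B C D i j : Z) : Z :=
  (A * i * j + 2 * B * i + 2 * C * j + 4 * D)%Z.

Definition corners_positive (A B C D : Z) (c d : sign) : bool :=
  forallb (fun k => 0 <? k)%Z
    [corner A B C D (lo c) (lo d); corner A B C D (lo c) (hi d);
     corner A B C D (hi c) (lo d); corner A B C D (hi c) (hi d)].

(* After each expansion the roles of the two unknowns are exchanged. The
   conditional keeps call-by-value evaluation from expanding refuted branches,
   which [||] would not. *)
Fixpoint refute (n : nat) (A B C D : Z) (c d : sign) : bool :=
  if corners_positive A B C D c d then true
  else if corners_positive (- A) (- B) (- C) (- D) c d then true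
  else match n with
  | O => false
  | S m =>
      refute m 0 C 0 D d Zero &&
      forallb
        (fun a => refute m C (A + a * C) D (B + a * D) d (sign_after a))
        (digits c)
  end.

Lemma affine_positive (p q l h t : R) :
  l <= t <= h -> 0 < p * l + q -> 0 < p * h + q -> 0 < p * t + q.
Proof. intros; destruct (Rle_or_lt 0 p); nra. Qed.

Lemma corners_positive_sound (A B C D : Z) (c d : sign) (u v : R) :
  corners_positive A B C D c d = true -> in_box c u -> in_box d v ->
  0 < IZR A * u * v + IZR B * u + IZR C * v + IZR D.
Proof.
  intros H Hu Hv.
  unfold corners_positive, forallb, corner in H.
  repeat (apply andb_prop in H as [?H H]).
  repeat match goal with
  | K : (_ <? _)%Z = true |- _ =>
      apply Z.ltb_lt, IZR_lt in K;
      rewrite ?plus_IZR, ?mult_IZR, ?plus_IZR, ?mult_IZR in K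
  end.
  unfold in_box in *.
  set (a := IZR A) in *; set (b := IZR B) in *.
  set (e := IZR C) in *; set (f := IZR D) in *.
  set (l := IZR (lo c)) in *; set (h := IZR (hi c)) in *.
  set (l' := IZR (lo d)) in *; set (h' := IZR (hi d)) in *.
  (* The form is affine in each variable: positivity passes from the corners to the two edges where
     [2 * u] is [l] or [h], then to the segment joining them at fixed [v]. *)
  assert (Hl : 0 < (a * l + 2 * e) * (2 * v) + (2 * b * l + 4 * f))
    by (apply affine_positive with l' h'; [exact Hv|lra|lra]).
  assert (Hh : 0 < (a * h + 2 * e) * (2 * v) + (2 * b * h + 4 * f))
    by (apply affine_positive with l' h'; [exact Hv|lra|lra]).
  assert (0 < (a * (2 * v) + 2 * b) * (2 * u) + (2 * e * (2 * v) + 4 * f))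
    by (apply affine_positive with l h; [exact Hu|lra|lra]).
  lra.
Qed.

Lemma refute_sound (n : nat) (A B C D : Z) (c d : sign) (u v : R) :
  refute n A B C D c d = true ->
  remainder 4 u -> remainder 4 v -> in_box c u -> in_box d v ->
  IZR A * u * v + IZR B * u + IZR C * v + IZR D <> 0.
Proof.
  revert A B C D c d u v; induction n as [|n IH];
    intros A B C D c d u v H Ru Rv Hu Hv E;
    cbn [refute] in H;
    (destruct (corners_positive A B C D c d) eqn:P;
     [apply (corners_positive_sound _ _ _ _ _ _ u v) in P; trivial; lra|]);
    (destruct (corners_positive (- A) (- B) (- C) (- D) c d) eqn:N;
     [apply (corners_positive_sound _ _ _ _ _ _ u v) in N; trivial;
      rewrite !opp_IZR in N; lra|]).
  - discriminate.
  - apply andb_prop in H as [H0 H].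
    destruct (Req_dec_T u 0) as [Zu|Nu].
    (* Only [C v + D = 0] remains. *)
    + apply (IH _ _ _ _ _ _ v u H0); trivial.
      * unfold in_box; simpl; lra.
      * subst u; lra.
    + destruct (remainder_digits c u Ru Hu Nu) as (a & w & Ia & Rw & Hw & Euw).
      rewrite forallb_forall in H.
      apply (IH _ _ _ _ _ _ v w (H a Ia)); trivial.
      rewrite !plus_IZR, !mult_IZR.
      (* The new form is the old one times [a + w], modulo the relation [u (a + w) = 1]. *)
      transitivity ((IZR A * u * v + IZR B * u + IZR C * v + IZR D) * (IZR a + w)
        + (IZR A * v + IZR B) * (1 - u * (IZR a + w))); [ring|].
      rewrite E, Euw; ring.
Qed.

Lemma remainder_sum_excluded (D : Z) (u v : R) :
  refute 10 0 94 94 D Any Any = true ->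
  remainder 4 u -> remainder 4 v -> 94 * u + 94 * v + IZR D <> 0.
Proof.
  intros H Ru Rv E.
  pose proof (remainder_bounds _ _ Ru); pose proof (remainder_bounds _ _ Rv).
  apply (refute_sound _ _ _ _ _ _ _ u v H); trivial; try (split; simpl; lra).
  lra.
Qed.

Theorem theorem6p3 :
  exists z : R, ~ exists x y : R, NICF 4 x /\ NICF 4 y /\ z = x + y.
Proof.
  exists (59 / 94); intros (x & y & Hx & Hy & E).
  assert (Ru : remainder 4 (x - IZR (nearest_int x))) by (exists x; auto).
  assert (Rv : remainder 4 (y - IZR (nearest_int y))) by (exists y; auto).
  pose proof (nearest_int_bounds x); pose proof (nearest_int_bounds y).
  set (k := (nearest_int x + nearest_int y)%Z).
  assert (Ek : IZR k = IZR (nearest_int x) + IZR (nearest_int y))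
    by apply plus_IZR.
  (* The remainders sum to [59/94 - k], which lies in [-1, 1). *)
  assert (-1 < k)%Z by (apply lt_IZR; lra).
  assert (k < 2)%Z by (apply lt_IZR; lra).
  assert (Hk : k = 0%Z \/ k = 1%Z) by lia.
  destruct Hk as [Hk|Hk]; rewrite Hk in Ek.
  - refine (remainder_sum_excluded (-59) _ _ _ Ru Rv _);
      [vm_compute; reflexivity|lra].
  - refine (remainder_sum_excluded 35 _ _ _ Ru Rv _);
      [vm_compute; reflexivity|lra].
Qed.
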